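(* Let $K_{n+1}^D$ be the complete signed graph on $[n+1]$, with edges $(i,j,-)$ and $(i,j,+)$, each with multiplicity one, for all $1\le i<j\le n+1$. The polytope $CRYD_{n+1}=\mathcal{F}_{K^D_{n+1}}(2,0,\ldots,0)$ has exactly $3^n-2^n$ vertices.
   Context: For a signed graph $G$ on $[n+1]=\{1,\ldots,n+1\}$ associate to a negative edge $(i,j,-)$, $i<j$, the vector $\mathbf{e}_i-\mathbf{e}_j$ and to a positive edge $(i,j,+)$ the vector $\mathbf{e}_i+\mathbf{e}_j$ in $\mathbb{R}^{n+1}$. Let $M_G$ be the matrix whose columns are these vectors. For $\mathbf{a}\in\mathbb{Z}^{n+1}$ the flow polytope is $\mathcal{F}_G(\mathbf{a})=\{f\in\mathbb{R}_{\ge0}^{E(G)}:M_Gf=\mathbf{a}\}$. *)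

(* Defs.v *)
From mathcomp Require Import all_boot all_order all_algebra.
From mathcomp Require Import boolp classical_sets cardinality reals.

Set Implicit Arguments.
Unset Strict Implicit.
Unset Printing Implicit Defensive.

Import Order.TTheory GRing.Theory Num.Theory.

Local Open Scope classical_set_scope.
Local Open Scope ring_scope.

(* Edges form an arbitrary finite type, so multiple edges are allowed. *)
Record sgraph (m : nat) := SGraph {
  edge : finType;
  src : edge -> 'I_m;
  tgt : edge -> 'I_m;
  positive : edge -> bool;
  src_lt_tgt : forall e, (src e < tgt e)%N
}.

Definition edge_vec (R : pzRingType) (m : nat) (G : sgraph m) (e : edge G) :
    'cV[R]_m :=
  if positive e then delta_mx (src e) 0 + delta_mx (tgt e) 0
  else delta_mx (src e) 0 - delta_mx (tgt e) 0.

(* Column k corresponds to the k-th edge in the enumeration of the edge type,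
   so that R^E(G) is realised as 'cV[R]_#|edge G|. *)
Definition incidence_mx (R : pzRingType) (m : nat) (G : sgraph m) :
    'M[R]_(m, #|edge G|) :=
  \matrix_(i < m, k < #|edge G|) edge_vec R (enum_val k) i 0.

Definition flow_polytope (R : realType) (m : nat) (G : sgraph m)
    (a : 'cV[int]_m) : set 'cV[R]_#|edge G| :=
  [set f : 'cV[R]_#|edge G| | (forall k, 0 <= f k 0) /\
           incidence_mx R G *m f = map_mx intr a].

Arguments flow_polytope R {m} G a _.

(* The extreme points of P: the points of P not in the relative interior of any
   nondegenerate segment contained in P. *)
Definition vertices (R : realType) (V : lmodType R) (P : set V) : set V :=
  [set x | P x /\
    forall (y z : V) (t : R), P y -> P z -> 0 < t < 1 ->
      x = t *: y + (1 - t) *: z -> y = x /\ z = x].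

(* ((i, j), s) with i < j; s = true is the edge (i, j, +). *)
Definition complete_edge (m : nat) : finType :=
  {e : ('I_m * 'I_m) * bool | (e.1.1 < e.1.2)%N}.

Definition complete_sgraph (m : nat) : sgraph m :=
  @SGraph m (complete_edge m)
    (fun e => (val e).1.1) (fun e => (val e).1.2) (fun e => (val e).2)
    (fun e => valP e).

(* The vector (2, 0, ..., 0). *)
Definition CRYD_netflow (n : nat) : 'cV[int]_n.+1 :=
  \col_(i < n.+1) (if i == ord0 then 2 else 0).

(* Index shift: CRYD R n is the polytope CRYD_{n+1}, on n + 1 graph vertices. *)
Definition CRYD (R : realType) (n : nat) :
    set 'cV[R]_#|edge (complete_sgraph n.+1)| :=
  flow_polytope R (complete_sgraph n.+1) (CRYD_netflow n).

Arguments CRYD R n _ : clear implicits.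

(* Main.v *)
Require Import Defs.
From mathcomp Require Import all_boot all_order all_algebra.
From mathcomp Require Import boolp classical_sets cardinality reals.
From mathcomp Require Import zify lra.

Set Implicit Arguments.
Unset Strict Implicit.
Unset Printing Implicit Defensive.

Import Order.TTheory GRing.Theory Num.Theory.

Local Open Scope ring_scope.

(** A point of a polytope cut out of the nonnegative orthant by linear equations
    is a vertex exactly when no other point of the polytope has its support
    inside the support of that point ([flow_vertexP]), so the vertices to be
    counted are the flows of minimal support.

    Call a fork a pair of subsets A, B of the vertex set, both containing the
    source 0, with distinct maxima, such that any common element has the same
    predecessors in A as in B. Read increasingly, A and B are two paths of
    negative edges which run together from 0 and never meet again once they have
    parted. Sending one unit along each path and one unit along the positive edge
    that joins their ends gives a flow with netflow (2, 0, ..., 0), since a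
    positive edge absorbs its weight at both of its ends ([fork_in_CRYD]).

    Fork flows are exactly the flows of minimal support:
    - in any flow, the positive edges carry total weight 1 (add up all the
      conservation equations). So some positive edge (i, j, +) is used; every
      vertex other than 0 that emits flow also receives some, through a negative
      edge from a smaller vertex. Choosing one such parent for every vertex, the
      chains of ancestors of i and j form a fork whose flow is supported inside
      the given flow ([support_fork]);
    - in a fork flow only one positive edge is used and each vertex receives
      from at most one negative edge. The first fact fixes the weight of the
      positive edge, and then the conservation equations, read from the largest
      vertex down, determine all the other weights ([unique_parent_rigid]).

    To count unordered forks, let B be the path that contains the smallest
    element on which A and B differ, and mark each vertex by [Some false] if it
    is in A, by [Some true] if it is in B only, by [None] otherwise. Conversely B
    is the set of the vertices marked [Some true] together with those elements of
    A that precede all of them. Thus forks correspond to the markings of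
    1, ..., n by three symbols in which the symbol [Some true] occurs, and there
    are 3^n - 2^n of these ([fork_code], [code_flow_inj], [card_codes]). *)

(** * Vertices as flows of minimal support *)

(** If the support of y is inside that of x, then x - t y is still nonnegative
    for small t > 0, which puts x inside a segment starting at y. Conversely
    both ends of a segment through x have their support inside that of x. *)
Lemma flow_vertexP (R : realType) (m : nat) (G : sgraph m) (a : 'cV[int]_m)
    (x : 'cV[R]_#|edge G|) :
  vertices (flow_polytope R G a) x <->
  flow_polytope R G a x /\
  (forall y, flow_polytope R G a y -> (forall k, x k 0 = 0 -> y k 0 = 0) ->
   y = x).
Proof.
split=> [[Px vx]|[Px minx]]; split=> //.
- move=> y Py suppy.
  have [[x0 xa] [y0 ya]] := (Px, Py).
  pose s := \sum_k y k 0 / x k 0.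
  have q0 k : 0 <= y k 0 / x k 0 by rewrite divr_ge0.
  have s0 : 0 <= s by apply: sumr_ge0 => k _.
  (* Small enough: for each k, the ratio y_k / x_k is at most s < 1 / t. A zero
     x_k contributes y_k / 0 = 0 to s. *)
  pose t := (2 + s)^-1.
  have s2 : 0 < 2 + s by rewrite ltr_wpDr.
  have t0 : 0 < t by rewrite invr_gt0.
  have t1 : t < 1 by rewrite invf_lt1 //; lra.
  have tyx k : t * y k 0 <= x k 0.
    rewrite mulrC ler_pdivrMr //.
    have [xk0|xk0] := eqVneq (x k 0) 0; first by rewrite (suppy k xk0) xk0 mul0r.
    rewrite -{1}(divfK xk0 (y k 0)) mulrC ler_wpM2l //.
    have : y k 0 / x k 0 <= s.
      by rewrite /s (bigD1 k) //= lerDl; apply: sumr_ge0 => j _.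
    lra.
  have ut : 1 - t != 0 by rewrite subr_eq0 gt_eqF.
  (* The point beyond x on the ray from y through x. *)
  pose z := (1 - t)^-1 *: (x - t *: y).
  have Pz : flow_polytope R G a z.
    split=> [k|].
      by rewrite !mxE mulr_ge0 ?invr_ge0 ?subr_ge0 ?tyx // ltW.
    rewrite -scalemxAr mulmxBr -scalemxAr xa ya -{1}[map_mx _ _]scale1r.
    by rewrite -scalerBl scalerA mulVf ?scale1r.
  have [||] // := vx y z t Py Pz; first by rewrite t0 t1.
  by rewrite /z scalerA mulfV // scale1r addrC subrK.
- have suppE y z t : flow_polytope R G a y -> flow_polytope R G a z ->
      0 < t -> 0 < 1 - t -> x = t *: y + (1 - t) *: z -> y = x.
    move=> Py [z0 _] t0 t1 xE; apply: minx => // k; rewrite xE !mxE => /eqP.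
    have y0 := Py.1 k.
    rewrite paddr_eq0 ?(mulr_ge0 (ltW _)) //.
    by case/andP; rewrite mulf_eq0 gt_eqF //= => /eqP.
  move=> y z t Py Pz /andP[t0 t1] xE.
  have t1' : 0 < 1 - t by rewrite subr_gt0.
  split; first exact: suppE xE.
  apply: (suppE z y (1 - t)) => //; first by rewrite subKr.
  by rewrite subKr addrC.
Qed.

(** * Flows on the complete signed graph as edge weights *)

(** Coordinates of a flow indexed by pairs of vertices instead of edge numbers:
    the pairs that are not edges get weight 0, so that sums can range over all
    vertices. *)
Definition weight (R : realType) (m : nat)
    (f : 'cV[R]_#|edge (complete_sgraph m)|) (s : bool) (i j : 'I_m) : R :=
  if insub ((i, j), s) is Some e then
    f (@enum_rank (edge (complete_sgraph m)) e) 0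
  else 0.

Definition flow_of (R : realType) (m : nat) (w : bool -> 'I_m -> 'I_m -> R) :
    'cV[R]_#|edge (complete_sgraph m)| :=
  \col_k let e := val (enum_val k : complete_edge m) in w e.2 e.1.1 e.1.2.

Lemma weight_ge (R : realType) (m : nat)
    (f : 'cV[R]_#|edge (complete_sgraph m)|) s (i j : 'I_m) :
  (j <= i)%N -> weight f s i j = 0.
Proof. by move=> ji; rewrite /weight insubF //= ltnNge ji. Qed.

Lemma weight_val (R : realType) (m : nat)
    (f : 'cV[R]_#|edge (complete_sgraph m)|) k :
  let e := val (enum_val k : complete_edge m) in
  weight f e.2 e.1.1 e.1.2 = f k 0.
Proof.
rewrite /weight /=; set e : complete_edge m := enum_val k.
have -> : ((val e).1.1, (val e).1.2, (val e).2) = val e.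
  by case: (val e) => [[i j] s].
by rewrite valK /e enum_valK.
Qed.

Lemma weight_flow_of (R : realType) (m : nat) (w : bool -> 'I_m -> 'I_m -> R)
    s (i j : 'I_m) :
  (i < j)%N -> weight (flow_of w) s i j = w s i j.
Proof. by move=> ij; rewrite /weight insubT mxE enum_rankK. Qed.

Lemma weight_inj (R : realType) (m : nat)
    (f g : 'cV[R]_#|edge (complete_sgraph m)|) :
  (forall s i j, weight f s i j = weight g s i j) -> f = g.
Proof.
by move=> fg; apply/colP => k; rewrite -!weight_val fg.
Qed.

Lemma incidence_weight (R : realType) (m : nat)
    (f : 'cV[R]_#|edge (complete_sgraph m)|) (v : 'I_m) :
  (incidence_mx R (complete_sgraph m) *m f) v 0 =
  \sum_w (weight f true v w + weight f false v w) +
  \sum_u (weight f true u v - weight f false u v).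
Proof.
pose E := (('I_m * 'I_m) * bool)%type.
pose g (e : E) : R := weight f e.2 e.1.1 e.1.2 *
  ((v == e.1.1)%:R + (-1) ^+ (~~ e.2) * (v == e.1.2)%:R).
have -> : (incidence_mx R (complete_sgraph m) *m f) v 0 = \sum_e g e.
  rewrite mxE (bigID (fun e : E => (e.1.1 < e.1.2)%N)) /=.
  rewrite [X in _ + X]big1 ?addr0; last first.
    by move=> e; rewrite -leqNgt /g => /weight_ge->; rewrite mul0r.
  transitivity (\sum_(e : complete_edge m) g (val e)); last first.
    by rewrite [RHS](big_sub (fun e : E => (e.1.1 < e.1.2)%N)).
  rewrite (reindex (fun k : 'I_#|edge (complete_sgraph m)| =>
    enum_val k : complete_edge m)) /=; last exact/onW_bij/enum_val_bij.
  apply: eq_bigr => k _; rewrite /g weight_val mxE mulrC; congr (_ * _).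
  rewrite /edge_vec /=; case: (sval (enum_val k)) => [[i j] []] /=;
    by rewrite !mxE !eqxx !andbT ?mul1r // mulN1r.
rewrite -(pair_bigA _ (fun ij s => g (ij, s))) /=.
rewrite -(pair_bigA _ (fun i j => \sum_s g (i, j, s))) /=.
under eq_bigr do under eq_bigr do
  rewrite big_bool /g /= !(mulrDr, mul1r, mulN1r) addrACA -mulrDl mulrN -mulrBl.
under eq_bigr do rewrite big_split /=.
rewrite big_split /=; congr (_ + _).
  rewrite (bigD1 v) //= [X in _ + X]big1 ?addr0.
    by apply: eq_bigr => w _; rewrite eqxx mulr1.
  by move=> i iv; rewrite big1 // => w _; rewrite eq_sym (negPf iv) mulr0.
apply: eq_bigr => u _; rewrite (bigD1 v) //= eqxx mulr1 big1 ?addr0 //.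
by move=> w wv; rewrite eq_sym (negPf wv) mulr0.
Qed.

(** Conservation, written without subtraction: what leaves v through its edges
    to larger vertices and through its positive edges to smaller ones comes from
    the source or through negative edges. *)
Lemma CRYDP (R : realType) (n : nat)
    (f : 'cV[R]_#|edge (complete_sgraph n.+1)|) :
  CRYD R n f <->
  (forall s i j, 0 <= weight f s i j) /\
  (forall v, \sum_w (weight f true v w + weight f false v w) +
             \sum_u weight f true u v =
             2 * (v == ord0)%:R + \sum_u weight f false u v).
Proof.
have aE v : (map_mx intr (CRYD_netflow n) : 'cV[R]__) v 0 = 2 * (v == ord0)%:R.
  by rewrite !mxE; case: ifP; rewrite ?mulr1 ?mulr0.
split=> [[f0 fa]|[f0 fa]]; split.
- by move=> s i j; rewrite /weight; case: insub.
- move=> v; rewrite -aE -fa incidence_weight sumrB.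
  by rewrite addrA subrK.
- by move=> k; rewrite -weight_val.
- apply/colP => v; rewrite incidence_weight sumrB addrA fa aE.
  by rewrite addrK.
Qed.

(** In the sum of all conservation equations each negative edge cancels and each
    positive edge counts twice, against a total netflow of 2. *)
Lemma positive_weight_sum (R : realType) (n : nat)
    (f : 'cV[R]_#|edge (complete_sgraph n.+1)|) :
  CRYD R n f -> \sum_u \sum_v weight f true u v = 1.
Proof.
move=> /CRYDP[_ fa].
have : \sum_v (\sum_w (weight f true v w + weight f false v w) +
             \sum_u weight f true u v) =
   \sum_v (2 * (v == ord0)%:R + \sum_u weight f false u v).
  by apply: eq_bigr => v _; exact: fa.
rewrite !big_split /= [X in _ = _ + X]exchange_big /=.
rewrite [X in _ + X = _]exchange_big /=.
under eq_bigr do rewrite big_split /=.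
rewrite big_split /= -mulr_sumr.
have -> : \sum_(v < n.+1) (v == ord0)%:R = 1 :> R.
  by rewrite (bigD1 ord0) //= big1 ?addr0 // => i /negPf->.
lra.
Qed.

(** The unique positive edge carries the whole positive weight 1. Then the
    inflow at v is determined by the edges from v to larger vertices; since it
    all comes through one edge, the weight of that edge is determined, and
    descending induction on v reaches every edge. *)
Lemma unique_parent_rigid (R : realType) (n : nat) (a b : 'I_n.+1)
    (x y : 'cV[R]_#|edge (complete_sgraph n.+1)|) :
  CRYD R n x -> CRYD R n y ->
  (forall s i j, weight x s i j = 0 -> weight y s i j = 0) ->
  (forall i j, weight x true i j != 0 -> i = a /\ j = b) ->
  (forall u u' v, weight x false u v != 0 -> weight x false u' v != 0 ->
     u = u') ->
  y = x.
Proof.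
move=> Cx Cy suppy posx parx.
have supp0 f : (forall s i j, weight x s i j = 0 -> weight f s i j = 0) ->
    CRYD R n f -> forall i j, weight f true i j = ((i == a) && (j == b))%:R.
  move=> suppf Cf i j.
  have f0 i' j' : ~~ ((i' == a) && (j' == b)) -> weight f true i' j' = 0.
    move=> nab; apply: suppf; apply/eqP; apply: contraNT nab => /posx[-> ->].
    by rewrite !eqxx.
  case: (boolP (_ && _)) => [/andP[/eqP-> /eqP->]|/f0//].
  have := positive_weight_sum Cf.
  rewrite (bigD1 a) //= (bigD1 b) //= !big1 ?addr0 // => [i' i'a|i' i'a].
    by rewrite big1 // => j' _; rewrite f0 ?(negPf i'a).
  by rewrite f0 // (negPf i'a) andbF.
have yxT i j : weight y true i j = weight x true i j by rewrite !supp0.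
suff yxF v : forall u, weight y false u v = weight x false u v.
  by apply: weight_inj => -[].
have [k] := ubnP (n - v); elim: k v => // k IHk v vk u.
have [uv|vu] := ltnP u v; last by rewrite !weight_ge.
have insum : \sum_u weight y false u v = \sum_u weight x false u v.
  have [[_ /(_ v) ay] [_ /(_ v) ax]] := ((CRYDP _).1 Cy, (CRYDP _).1 Cx).
  apply: (addrI (2 * (v == ord0)%:R)); rewrite -ay -ax.
  congr (_ + _); last by apply: eq_bigr.
  apply: eq_bigr => w _; rewrite yxT; congr (_ + _).
  have [vw|wv] := ltnP v w; last by rewrite !weight_ge.
  by apply: IHk; have := ltn_ord w; lia.
have [xu0|xu0] := eqVneq (weight x false u v) 0; first by rewrite xu0 suppy.
have others u' : u' != u -> weight x false u' v = 0.
  by apply: contraNeq => xu'; apply/eqP/(parx _ _ v).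
move: insum; rewrite (bigD1 u) //= [X in _ = X](bigD1 u) //= !big1 ?addr0 //.
by move=> u' /others /suppy.
Qed.

(** * Forks and their flows *)

(** The negative edges of the path that visits the elements of A in order. *)
Definition consec (m : nat) (A : {set 'I_m}) (u v : 'I_m) : bool :=
  [&& u \in A, v \in A, (u < v)%N & [forall w in A, ~~ (u < w < v)%N]].

Definition top (n : nat) (A : {set 'I_n.+1}) : 'I_n.+1 :=
  [arg max_(v > ord0 in A) val v]%N.

Lemma topP (n : nat) (A : {set 'I_n.+1}) :
  ord0 \in A -> top A \in A /\ forall v, v \in A -> (v <= top A)%N.
Proof. by move=> A0; rewrite /top; case: arg_maxnP. Qed.

Lemma consecP (m : nat) (A : {set 'I_m}) (u v : 'I_m) :
  reflect [/\ u \in A, v \in A, (u < v)%N &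
             forall w, w \in A -> (u < w)%N -> (v <= w)%N] (consec A u v).
Proof.
apply: (iffP and4P) => -[Au Av uv].
  by move=> /forall_inP no; split=> // w /no; lia.
by move=> no; split=> //; apply/forall_inP => w /no; lia.
Qed.

Lemma consec_prev (n : nat) (A : {set 'I_n.+1}) (v : 'I_n.+1) :
  ord0 \in A -> v \in A -> v != ord0 -> exists u, consec A u v.
Proof.
move=> A0 Av v0; pose P u := (u \in A) && (u < v)%N.
have P0 : P ord0 by rewrite /P A0 lt0n -(inj_eq val_inj) in v0 *.
case: (arg_maxnP val P0) => u /andP[Au uv] umax.
exists u; apply/consecP; split=> // w Aw uw.
rewrite leqNgt; apply/negP => wv.
by have /= := umax w; rewrite /P Aw wv leqNgt uw => /(_ isT).
Qed.

Lemma consec_next (n : nat) (A : {set 'I_n.+1}) (v : 'I_n.+1) :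
  ord0 \in A -> v \in A -> v != top A -> exists u, consec A v u.
Proof.
move=> A0 Av vtop; pose P u := (u \in A) && (v < u)%N.
have [Atop topmax] := topP A0.
have Ptop : P (top A).
  by rewrite /P Atop ltn_neqAle topmax // andbT.
case: (arg_minnP val Ptop) => u /andP[Au uv] umin.
exists u; apply/consecP; split=> // w Aw vw.
by apply: umin; rewrite /P Aw.
Qed.

Lemma consec_prev_uniq (m : nat) (A : {set 'I_m}) (u u' v : 'I_m) :
  consec A u v -> consec A u' v -> u = u'.
Proof.
move=> /consecP[Au _ uv no] /consecP[Au' _ u'v no']; apply: val_inj => /=.
by have := no u' Au'; have := no' u Au; lia.
Qed.

Lemma consec_next_uniq (m : nat) (A : {set 'I_m}) (u u' v : 'I_m) :
  consec A v u -> consec A v u' -> u = u'.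
Proof.
move=> /consecP[_ Au uv no] /consecP[_ Au' u'v no']; apply: val_inj => /=.
by have := no u' Au' u'v; have := no' u Au uv; lia.
Qed.

Lemma sum_at_most_one (R : pzSemiRingType) (T : finType) (P : pred T) :
  (forall u v, P u -> P v -> u = v) ->
  \sum_u (P u)%:R = ([exists u, P u])%:R :> R.
Proof.
move=> uniqP; case: (boolP [exists u, P u]) => [/existsP[u Pu]|].
  rewrite (bigD1 u) //= Pu big1 ?addr0 // => v vu.
  by case: (boolP (P v)) => // /(uniqP u v Pu) uv; rewrite uv eqxx in vu.
by rewrite negb_exists => /forallP no; rewrite big1 // => u _; rewrite (negPf (no u)).
Qed.

Lemma sum_consec_in (R : pzSemiRingType) (n : nat) (A : {set 'I_n.+1}) v :
  ord0 \in A ->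
  \sum_u (consec A u v)%:R = ((v \in A) && (v != ord0))%:R :> R.
Proof.
move=> A0; rewrite sum_at_most_one; last first.
  by move=> u u' uv u'v; apply: consec_prev_uniq uv u'v.
congr ((nat_of_bool _)%:R); apply/existsP/andP => [[u /consecP[_ Av uv _]]|[Av v0]].
  by split=> //; rewrite -(inj_eq val_inj) /=; lia.
exact: consec_prev.
Qed.

Lemma sum_consec_out (R : pzSemiRingType) (n : nat) (A : {set 'I_n.+1}) v :
  ord0 \in A ->
  \sum_w (consec A v w)%:R = ((v \in A) && (v != top A))%:R :> R.
Proof.
move=> A0; rewrite sum_at_most_one; last first.
  by move=> u u' vu vu'; apply: consec_next_uniq vu vu'.
congr ((nat_of_bool _)%:R); apply/existsP/andP => [[u /consecP[Av Au uv _]]|[Av v0]].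
  split=> //; apply/eqP => vtop; have := (topP A0).2 u Au.
  by rewrite vtop in uv; lia.
exact: consec_next.
Qed.

(** The last clause says that a common vertex has the same predecessors on both
    paths: the paths share an initial stretch and are disjoint afterwards. It is
    what gives every vertex a single parent in the union of the paths. *)
Definition is_fork (n : nat) (A B : {set 'I_n.+1}) : Prop :=
  [/\ ord0 \in A, ord0 \in B, top A != top B &
      forall u v : 'I_n.+1, v \in A -> v \in B -> (u < v)%N ->
        (u \in A) = (u \in B)].

Definition fork_weight (R : realType) (n : nat) (A B : {set 'I_n.+1})
    (s : bool) (u v : 'I_n.+1) : R :=
  if s then ((u < v)%N && ((u == top A) && (v == top B) ||
                           (u == top B) && (v == top A)))%:R
  else (consec A u v)%:R + (consec B u v)%:R.

Arguments fork_weight : simpl never.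

Definition fork_flow (R : realType) (n : nat) (A B : {set 'I_n.+1}) :
    'cV[R]_#|edge (complete_sgraph n.+1)| :=
  flow_of (fork_weight R A B).

Lemma weight_fork (R : realType) (n : nat) (A B : {set 'I_n.+1}) s u v :
  weight (fork_flow R A B) s u v = fork_weight R A B s u v.
Proof.
have [uv|vu] := ltnP u v; first by rewrite weight_flow_of.
rewrite weight_ge // /fork_weight ltnNge vu /= /consec ltnNge vu !andbF.
by case: s; rewrite ?addr0.
Qed.

Lemma fork_flowC (R : realType) (n : nat) (A B : {set 'I_n.+1}) :
  fork_flow R A B = fork_flow R B A.
Proof.
apply: weight_inj => s u v; rewrite !weight_fork /fork_weight.
by case: s; [rewrite orbC | rewrite addrC].
Qed.

Lemma is_forkC (n : nat) (A B : {set 'I_n.+1}) : is_fork A B -> is_fork B A.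
Proof.
case=> A0 B0 AB common; split=> //; first by rewrite eq_sym.
by move=> u v Bv Av uv; rewrite (common u v).
Qed.

(** Along one path the outflow minus the inflow is 1 at 0 and -1 at the top; the
    positive edge takes one unit out of each of the two tops. *)
Lemma fork_in_CRYD (R : realType) (n : nat) (A B : {set 'I_n.+1}) :
  is_fork A B -> CRYD R n (fork_flow R A B).
Proof.
case=> A0 B0 AB _; apply/CRYDP; split=> [s i j|v].
  by rewrite weight_fork /fork_weight; case: s; rewrite ?addr_ge0 ?ler0n.
under eq_bigr do rewrite !weight_fork.
under [X in _ + X]eq_bigr do rewrite !weight_fork.
under [in RHS]eq_bigr do rewrite !weight_fork.
rewrite big_split /= !big_split /= !sum_consec_in // !sum_consec_out //.
(* Of all the positive edges at v, only the one that joins the tops has weight,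
   and it is at v exactly when v is one of the tops. *)
have pos : \sum_w fork_weight R A B true v w + \sum_u fork_weight R A B true u v
    = (v == top A)%:R + (v == top B)%:R.
  rewrite -big_split /= (bigID (fun w => (w == top A) || (w == top B))) /=.
  rewrite [X in _ + X]big1 ?addr0; last first.
    move=> w /norP[/negPf wA /negPf wB].
    by rewrite /fork_weight wA wB !andbF !addr0.
  have wE w : fork_weight R A B true v w + fork_weight R A B true w v =
      (((v == top A) && (w == top B)) || ((v == top B) && (w == top A)))%:R.
    rewrite /fork_weight; case: (ltngtP v w) => [vw|wv|/val_inj vw] /=.
    - by rewrite addr0.
    - by rewrite add0r orbC; congr ((nat_of_bool (_ || _))%:R); exact: andbC.
    - rewrite vw addr0; case: eqVneq => [->|_]; rewrite ?(negPf AB) ?andbF //.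
  under eq_bigr do rewrite wE.
  rewrite (bigD1 (top A)) ?eqxx //= (bigD1 (top B)) /=; last first.
    by rewrite eqxx orbT eq_sym.
  rewrite big1 ?addr0 => [|w]; last first.
    by case/andP=> /andP[/orP[]/eqP-> //]; rewrite eqxx.
  have BA : top B != top A by rewrite eq_sym.
  by rewrite !eqxx !andbT (negPf AB) (negPf BA) !andbF orbF /= addrC.
rewrite -addrA [_ + \sum_u _]addrC addrA pos.
have [[Atop _] [Btop _]] := (topP A0, topP B0).
have side (D : {set 'I_n.+1}) : ord0 \in D -> top D \in D ->
    (v == top D)%:R + ((v \in D) && (v != top D))%:R =
    (v == ord0)%:R + ((v \in D) && (v != ord0))%:R :> R.
  move=> D0 Dtop.
  have split1 w : w \in D -> (v == w)%:R + ((v \in D) && (v != w))%:R =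
      (v \in D)%:R :> R.
    by move=> Dw; case: eqVneq => [->|_]; rewrite ?Dw ?andbF ?andbT ?addr0 ?add0r.
  by rewrite !split1.
have := side A A0 Atop; have := side B B0 Btop; lra.
Qed.

Lemma fork_vertex (R : realType) (n : nat) (A B : {set 'I_n.+1}) :
  is_fork A B -> vertices (CRYD R n) (fork_flow R A B).
Proof.
move=> forkAB; apply/flow_vertexP.
split=> [|y Cy suppy]; first exact: fork_in_CRYD.
have [_ _ AB _] := forkAB.
wlog ltAB : A B forkAB AB suppy / (top A < top B)%N.
  move=> wl; have [lt|gt|/val_inj eq] := ltngtP (top A) (top B).
  - exact: wl.
  - rewrite fork_flowC in suppy *; apply: wl => //; last by rewrite eq_sym.
    exact: is_forkC.
  - by rewrite eq eqxx in AB.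
have [A0 B0 _ common] := forkAB.
apply: (@unique_parent_rigid _ _ (top A) (top B)) => //.
- exact: fork_in_CRYD.
- move=> s i j; rewrite /weight; case: insubP => [e _ _|//].
  exact: suppy.
- move=> i j; rewrite weight_fork /fork_weight pnatr_eq0 eqb0 negbK.
  case/andP=> ij /orP[/andP[/eqP-> /eqP->] //|/andP[/eqP iB /eqP jA]].
  by move: ij; rewrite iB jA; lia.
- have supp u v : weight (fork_flow R A B) false u v != 0 ->
      consec A u v \/ consec B u v.
    rewrite weight_fork /fork_weight; case: (consec A u v) => /=; first by left.
    by case: (consec B u v) => /=; [right | rewrite addr0 eqxx].
  (* A vertex on both paths has the same elements of A and of B below it, hence
     the same predecessor. *)
  have cross u u' v : consec A u v -> consec B u' v -> u = u'.
    move=> /consecP[Au Av uv noA] /consecP[Bu' Bv u'v noB].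
    have := noB u; rewrite -(common u v) // => /(_ Au).
    have := noA u'; rewrite (common u' v) // => /(_ Bu').
    by move=> ? ?; apply: val_inj => /=; lia.
  move=> u u' v /supp[] h /supp[] h'.
  + exact: consec_prev_uniq h h'.
  + exact: cross h h'.
  + by rewrite (cross _ _ _ h' h).
  + exact: consec_prev_uniq h h'.
Qed.

(** * Every flow supports a fork *)

Definition is_parent (n : nat) (p : 'I_n.+1 -> 'I_n.+1) : Prop :=
  p ord0 = ord0 /\ forall v, v != ord0 -> (p v < v)%N.

Definition ancestors (n : nat) (p : 'I_n.+1 -> 'I_n.+1) (k : 'I_n.+1) :
    {set 'I_n.+1} :=
  [set v | fconnect p k v].

Lemma ancestors_self (n : nat) (p : 'I_n.+1 -> 'I_n.+1) k :
  k \in ancestors p k.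
Proof. by rewrite inE connect0. Qed.

Lemma ancestors_trans (n : nat) (p : 'I_n.+1 -> 'I_n.+1) k v w :
  v \in ancestors p k -> w \in ancestors p v -> w \in ancestors p k.
Proof. by rewrite !inE; apply: connect_trans. Qed.

Lemma ancestors_parent (n : nat) (p : 'I_n.+1 -> 'I_n.+1) k :
  p k \in ancestors p k.
Proof. by rewrite inE fconnect1. Qed.

Lemma ancestorsE (n : nat) (p : 'I_n.+1 -> 'I_n.+1) k v :
  (v \in ancestors p k) = (v == k) || (v \in ancestors p (p k)).
Proof.
apply/idP/orP => [|[/eqP->|]]; last 2 first.
- exact: ancestors_self.
- exact/ancestors_trans/ancestors_parent.
rewrite !inE => /iter_findex; case: findex => [<-|t <-]; first by left; rewrite eqxx.
by right; rewrite iterSr fconnect_iter.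
Qed.

(** Induction along the chain from k down to v; the parent is strictly smaller
    until the chain stops at 0. *)
Lemma ancestors_ind (n : nat) (p : 'I_n.+1 -> 'I_n.+1)
    (P : 'I_n.+1 -> 'I_n.+1 -> Prop) :
  is_parent p ->
  (forall k, P k k) ->
  (forall k v, k != ord0 -> v \in ancestors p (p k) -> P (p k) v -> P k v) ->
  forall k v, v \in ancestors p k -> P k v.
Proof.
move=> [p0 plt] Pself Pstep k; have [b] := ubnP k.
elim: b k => // b IH k kb v; rewrite ancestorsE.
case/orP=> [/eqP->//|vpk]; have [k0|k0] := eqVneq k ord0.
  move: vpk; rewrite k0 p0 inE => /iter_findex <-.
  by have -> : forall t, iter t p ord0 = ord0 by elim=> //= t ->.
by apply: Pstep => //; apply: IH => //; have := plt k k0; lia.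
Qed.

Lemma ancestors_le (n : nat) (p : 'I_n.+1 -> 'I_n.+1) k v :
  is_parent p -> v \in ancestors p k -> (v <= k)%N.
Proof.
move=> pp; move: k v; apply: (ancestors_ind pp) => // k v k0 _.
by have := pp.2 k k0; lia.
Qed.

Lemma ancestors0 (n : nat) (p : 'I_n.+1 -> 'I_n.+1) k :
  is_parent p -> ord0 \in ancestors p k.
Proof.
move=> [p0 plt]; have [b] := ubnP k; elim: b k => // b IH k kb.
rewrite ancestorsE; have [->//|k0] := eqVneq k ord0.
by rewrite IH ?orbT //; have := plt k k0; lia.
Qed.

(** The ancestors of k form a chain. This is why two chains of ancestors agree
    below each common element. *)
Lemma ancestors_below (n : nat) (p : 'I_n.+1 -> 'I_n.+1)
    (k u v : 'I_n.+1) :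
  is_parent p -> v \in ancestors p k -> (u <= v)%N ->
  (u \in ancestors p k) = (u \in ancestors p v).
Proof.
move=> pp vk uv; apply/idP/idP => [|uv']; last exact: ancestors_trans vk uv'.
move: k v vk uv; apply: (ancestors_ind pp) => // k v k0 vpk IH uv.
rewrite ancestorsE => /orP[/eqP uk|]; last exact: IH.
by have := ancestors_le pp vpk; have := pp.2 k k0; rewrite -uk; lia.
Qed.

Lemma top_ancestors (n : nat) (p : 'I_n.+1 -> 'I_n.+1) k :
  is_parent p -> top (ancestors p k) = k.
Proof.
move=> pp; have [tk kt] := topP (ancestors0 k pp).
apply: val_inj; apply/eqP; rewrite eqn_leq (ancestors_le pp tk) /=.
by rewrite kt ?ancestors_self.
Qed.

Lemma consec_ancestors (n : nat) (p : 'I_n.+1 -> 'I_n.+1) k u v :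
  is_parent p -> consec (ancestors p k) u v ->
  [/\ v \in ancestors p k, v != ord0 & u = p v].
Proof.
move=> pp /consecP[uk vk uv no].
have v0 : v != ord0 by rewrite -(inj_eq val_inj) /=; lia.
split=> //; have := uk; rewrite (ancestors_below pp vk) ?(ltnW uv) //.
rewrite ancestorsE => /orP[/eqP e|upv]; first by rewrite e ltnn in uv.
have pvk : p v \in ancestors p k by apply: ancestors_trans vk (ancestors_parent _ _).
have := no _ pvk; have := pp.2 v v0; have := ancestors_le pp upv.
by move=> ? ? h; apply: val_inj => /=; lia.
Qed.

Lemma ancestors_fork (n : nat) (p : 'I_n.+1 -> 'I_n.+1) i j :
  is_parent p -> i != j -> is_fork (ancestors p i) (ancestors p j).
Proof.
move=> pp ij; split; rewrite ?ancestors0 ?top_ancestors //.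
by move=> u v vi vj /ltnW uv; rewrite (ancestors_below pp vi) ?(ancestors_below pp vj).
Qed.

(** Only edges of positive weight are followed: the top edge (i, j, +) is in the
    support, and a vertex that emits flow has a parent in the support, which then
    emits flow too. *)
Lemma support_fork (R : realType) (n : nat)
    (f : 'cV[R]_#|edge (complete_sgraph n.+1)|) :
  CRYD R n f ->
  exists A B, is_fork A B /\
    forall s i j, weight f s i j = 0 -> fork_weight R A B s i j = 0.
Proof.
move=> Cf; have [f0 fa] := (CRYDP f).1 Cf.
have [i [j fij]] : exists i j, weight f true i j != 0.
  apply: contrapT => no; have := positive_weight_sum Cf.
  rewrite big1 => [/eqP|u _]; first by rewrite eq_sym oner_eq0.
  rewrite big1 // => v _; apply/eqP; apply: contrapT => /negP h.
  by apply: no; exists u, v.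
have wlt s u v : weight f s u v != 0 -> (u < v)%N.
  by rewrite ltnNge; apply: contraNN => /weight_ge->.
(* A vertex without incoming flow gets the parent 0 by default; such a vertex
   never occurs among the ancestors of i and j, except 0 itself. *)
pose q v := [pick u | weight f false u v != 0].
pose p v := if v == ord0 then ord0 else odflt ord0 (q v).
have pp : is_parent p.
  split=> [|v v0]; rewrite /p ?eqxx // (negPf v0) /q.
  by case: pickP => [u /wlt//|_] /=; rewrite lt0n.
pose out v := \sum_w (weight f true v w + weight f false v w) +
             \sum_u weight f true u v.
have out_ge v (a : R) : a <= \sum_w (weight f true v w + weight f false v w) \/
    a <= \sum_u weight f true u v -> a <= out v.
  rewrite /out => -[] h; [apply: ler_wpDr => // | apply: ler_wpDl => //];
    by apply: sumr_ge0 => w _ //; rewrite addr_ge0.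
have parent_edge v : v != ord0 -> 0 < out v -> weight f false (p v) v != 0.
  move=> v0; rewrite /out fa /p (negPf v0) mulr0 add0r /q.
  case: pickP => // no; rewrite big1 ?ltxx // => u _.
  by apply/eqP; have := no u; case: eqP.
have out_lt s u v : weight f s u v != 0 -> 0 < out u.
  rewrite neq_lt ltNge f0 /= => /lt_le_trans; apply; apply: out_ge; left.
  rewrite (bigD1 v) //=; have : 0 <= \sum_(w | w != v)
     (weight f true u w + weight f false u w).
    by apply: sumr_ge0 => w _; rewrite addr_ge0.
  by have := f0 true u v; have := f0 false u v; case: s; lra.
have out_j : 0 < out j.
  have := fij; rewrite neq_lt ltNge f0 /= => /lt_le_trans; apply.
  by apply: out_ge; right; rewrite (bigD1 i) //= lerDl; apply: sumr_ge0.
have out_anc k v : v \in ancestors p k -> 0 < out k -> 0 < out v.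
  move: k v; apply: (ancestors_ind pp) => // k v k0 _ IH outk.
  exact/IH/out_lt/(parent_edge k).
have consec0 k u v : 0 < out k -> consec (ancestors p k) u v ->
    weight f false u v != 0.
  move=> outk /(consec_ancestors pp)[vk v0 ->].
  by apply: parent_edge => //; apply: out_anc outk.
have ij : (i < j)%N := wlt _ _ _ fij.
exists (ancestors p i), (ancestors p j); split.
  by apply: ancestors_fork => //; rewrite -(inj_eq val_inj) neq_ltn ij.
move=> [] u v fuv; rewrite /fork_weight.
  rewrite !top_ancestors //; case: ltnP => //= uv.
  case: (eqVneq u i) => [ui|_] /=; case: (eqVneq v j) => [vj|_] //=.
  - by move: fij; rewrite -ui -vj fuv eqxx.
  - by case: eqP => // uj; move: ij; rewrite -ui -uj ltnn.
  - by rewrite andbC; case: eqP => // vi; move: ij; rewrite -vi -vj; lia.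
  - by case: eqP => //= uj; case: eqP => // vi; move: ij uv; rewrite -vi -uj; lia.
have nc k : 0 < out k -> consec (ancestors p k) u v = false.
  by move=> /(consec0 k u v) h; apply/negP => /h; rewrite fuv eqxx.
by rewrite !nc ?addr0 // (out_lt true i j).
Qed.

(** * Encoding forks by words in three letters *)

Definition pathA (n : nat) (c : {ffun 'I_n.+1 -> option bool}) :
    {set 'I_n.+1} :=
  [set v | c v == Some false].

(** The shared initial stretch is not marked separately: it consists of the
    elements of the first path that precede every vertex marked [Some true]. *)
Definition pathB (n : nat) (c : {ffun 'I_n.+1 -> option bool}) :
    {set 'I_n.+1} :=
  [set v | (c v == Some true) ||
           (c v == Some false) && [forall (u | c u == Some true), v < u]%N].

(** The source belongs to the first path, so the free letters are those at the n
    other vertices. *)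
Definition codes (n : nat) : {set {ffun 'I_n.+1 -> option bool}} :=
  [set c : {ffun 'I_n.+1 -> option bool} |
     (c ord0 == Some false) && [exists v, c v == Some true]].

Lemma mem_pathB (n : nat) (c : {ffun 'I_n.+1 -> option bool}) v :
  reflect (c v = Some true \/
     c v = Some false /\ forall u : 'I_n.+1, c u = Some true -> (v < u)%N)
    (v \in pathB c).
Proof.
rewrite inE; apply: (iffP orP) => -[/eqP cv|]; try by left.
  by case/andP=> /eqP cv /forall_inP lt; right; split=> // u /eqP/lt.
case=> cv lt; right; rewrite cv eqxx; apply/forall_inP => u /eqP; exact: lt.
Qed.

Lemma codes_fork (n : nat) (c : {ffun 'I_n.+1 -> option bool}) :
  c \in codes n -> is_fork (pathA c) (pathB c).
Proof.
rewrite inE => /andP[/eqP c0 /existsP[t /eqP ct]].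
have A0 : ord0 \in pathA c by rewrite inE c0.
have B0 : ord0 \in pathB c.
  apply/mem_pathB; right; split=> // u cu; rewrite lt0n.
  by apply/eqP => u0; move: cu; rewrite (_ : u = ord0) ?c0 //; apply: val_inj.
split=> //.
  have [Atop _] := topP A0; have [_ /(_ t) topB] := topP B0.
  apply/eqP => AB; move: Atop topB; rewrite AB inE => /eqP ctop.
  have [Btop _] := topP B0; case/mem_pathB: Btop => [|[_ /(_ t ct)]].
    by rewrite ctop.
  move=> lt; have tB : t \in pathB c by apply/mem_pathB; left.
  by move/(_ tB); lia.
move=> u v; rewrite inE => /eqP cv /mem_pathB[|[_ lt] uv]; first by rewrite cv.
apply/idP/mem_pathB => [|[cu|[cu _]]]; rewrite inE.
- move=> /eqP cu; right; split=> // w /lt; lia.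
- by have := lt u cu; lia.
- by rewrite cu.
Qed.

(** The first path is the one that misses the smallest element m of the symmetric
    difference; with the other choice m would precede all the vertices marked
    [Some true], so decoding would put it on the shared stretch. *)
Lemma fork_code (R : realType) (n : nat) (A B : {set 'I_n.+1}) :
  is_fork A B ->
  exists2 c, c \in codes n & fork_flow R A B = fork_flow R (pathA c) (pathB c).
Proof.
move=> forkAB; have [A0 B0 AB common] := forkAB.
pose D := (A :\: B) :|: (B :\: A).
have [d dD] : exists d, d \in D.
  apply/set0Pn; apply: contra_neq AB => D0; congr top; apply/setP => v.
  by move/setP/(_ v): D0; rewrite !inE; do 2 case: (v \in _).
have [m mD minD] : exists2 m : 'I_n.+1,
    m \in D & forall j : 'I_n.+1, j \in D -> (m <= j)%N.
  by case: (arg_minnP val dD) => m mD minD; exists m.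
wlog mB : A B forkAB A0 B0 AB common @D {d dD} mD minD / m \in B.
  move=> wl; have [mB|mB] := boolP (m \in B); first exact: (wl A B).
  have DC : (B :\: A) :|: (A :\: B) = D by rewrite finset.setUC.
  have mA : m \in A by move: mD; rewrite /D !inE (negPf mB) andbF orbF.
  rewrite fork_flowC; apply: wl => //; rewrite ?DC //.
  + exact: is_forkC.
  + by rewrite eq_sym.
  + by have [] := is_forkC forkAB.
have mA : m \notin A by move: mD; rewrite /D !inE mB andbT.
pose c : {ffun 'I_n.+1 -> option bool} :=
  [ffun v => if v \in A then Some false else if v \in B then Some true else None].
have cA v : (c v == Some false) = (v \in A).
  by rewrite ffunE; case: (v \in A); case: (v \in B).
have cB v : (c v == Some true) = (v \in B :\: A).
  by rewrite ffunE !inE; case: (v \in A); case: (v \in B).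
exists c.
  rewrite inE cA A0; apply/existsP; exists m; by rewrite cB inE mA.
congr fork_flow; apply/setP => v; first by rewrite inE cA.
apply/idP/mem_pathB => [vB|].
  have [vA|vA] := boolP (v \in A); last first.
    by left; apply/eqP; rewrite cB inE vA.
  right; split; first by apply/eqP; rewrite cA.
  move=> u /eqP; rewrite cB inE => /andP[uA uB].
  rewrite ltnNge leq_eqVlt; apply/negP => /orP[/eqP/val_inj uv|uv].
    by rewrite uv vA in uA.
  by rewrite (common u v) ?uB in uA.
case=> [/eqP|[/eqP + lt]]; first by rewrite cB inE => /andP[].
rewrite cA => vA; have : (v < m)%N.
  by apply: lt; apply/eqP; rewrite cB inE mA.
rewrite ltnNge; apply: contraNT => vB; apply: minD.
by rewrite /D !inE vA vB.
Qed.

Lemma fork_flow_active (R : realType) (n : nat) (A B : {set 'I_n.+1}) v :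
  ord0 \in A -> ord0 \in B -> v != ord0 ->
  \sum_u weight (fork_flow R A B) false u v = (v \in A)%:R + (v \in B)%:R.
Proof.
move=> A0 B0 v0; under eq_bigr do rewrite weight_fork.
by rewrite big_split /= !sum_consec_in // v0 !andbT.
Qed.

(** The inflow at v is the number of paths through v, so v is on one path only,
    both for c and for d. If it were on the first path of d, it would lie after
    the parting, so its predecessor on the second path of c would be marked
    [Some true] in c, hence in d, while being the predecessor of v on the first
    path of d. *)
Lemma code_true_inj (R : realType) (n : nat)
    (c d : {ffun 'I_n.+1 -> option bool}) (v : 'I_n.+1) :
  c \in codes n -> d \in codes n ->
  fork_flow R (pathA c) (pathB c) = fork_flow R (pathA d) (pathB d) ->
  (forall u : 'I_n.+1, (u < v)%N -> c u = d u) ->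
  v != ord0 -> c v = Some true -> d v = Some true.
Proof.
move=> Cc Cd flowE below v0 cv.
have [[Ac0 Bc0 _ _] [Ad0 Bd0 _ _]] := (codes_fork Cc, codes_fork Cd).
have : (v \in pathA c)%:R + (v \in pathB c)%:R =
       (v \in pathA d)%:R + (v \in pathB d)%:R :> R.
  by rewrite -!fork_flow_active // flowE.
have vBc : v \in pathB c by apply/mem_pathB; left.
rewrite vBc inE cv /= add0r.
have [vAd|vAd] := boolP (v \in pathA d); last first.
  case: mem_pathB => [[//|[dv _]]|_]; first by rewrite inE dv eqxx in vAd.
  by rewrite addr0 => /eqP; rewrite oner_eq0.
have [|vBd _] := boolP (v \in pathB d).
  by move=> _ /eqP; rewrite -[X in X == _]addr0 (inj_eq (addrI _)) eq_sym oner_eq0.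
have dv : d v = Some false by move: vAd; rewrite inE => /eqP.
have [t dt tv] : exists2 t : 'I_n.+1, d t = Some true & (t < v)%N.
  apply: contrapT => no; apply/negP: vBd; apply/negPn/mem_pathB; right; split=> //.
  move=> u du; rewrite ltnNge leq_eqVlt; apply/negP => /orP[/eqP/val_inj uv|uv].
    by rewrite uv dv in du.
  by apply: no; exists u.
have ct : c t = Some true by rewrite below.
have [u cuv] := consec_prev Bc0 vBc v0.
have [/mem_pathB uB _ uv no] := consecP _ _ _ cuv.
have cu : c u = Some true.
  case: uB => // -[cu lt]; have := no t; rewrite (lt t ct).
  have -> : t \in pathB c by apply/mem_pathB; left.
  by move=> /(_ isT isT); lia.
have : weight (fork_flow R (pathA d) (pathB d)) false u v != 0.
  rewrite -flowE weight_fork /fork_weight cuv.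
  by rewrite paddr_eq0 ?ler0n // oner_eq0 andbF.
rewrite weight_fork /fork_weight.
have -> : consec (pathB d) u v = false by rewrite /consec (negPf vBd) andbF.
have -> : consec (pathA d) u v = false.
  by rewrite /consec inE -below // cu.
by rewrite addr0 eqxx.
Qed.

Lemma code_flow_inj (R : realType) (n : nat) :
  {in codes n &, injective (fun c => fork_flow R (pathA c) (pathB c))}.
Proof.
move=> c d Cc Cd flowE; apply/ffunP => v.
have [k] := ubnP (v : nat); elim: k v => // k IH v vk.
have below (u : 'I_n.+1) : (u < v)%N -> c u = d u by move=> uv; apply: IH; lia.
have [v0|v0] := eqVneq v ord0.
  by move: Cc Cd; rewrite v0 !inE => /andP[/eqP-> _] /andP[/eqP-> _].
have true_eq : (c v == Some true) = (d v == Some true).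
  apply/eqP/eqP; first exact: (code_true_inj Cc Cd flowE).
  by apply: (code_true_inj Cd Cc (esym flowE)) => // u /below.
have active e : e \in codes n -> (e v != None) =
    (\sum_u weight (fork_flow R (pathA e) (pathB e)) false u v != 0).
  move=> Ce; have [A0 B0 _ _] := codes_fork Ce.
  rewrite fork_flow_active // paddr_eq0 ?ler0n // !pnatr_eq0 !eqb0 !inE.
  by case: (e v) => [[]|].
have := active c Cc; rewrite flowE -active //.
by move: true_eq; case: (c v) => [[]|]; case: (d v) => [[]|].
Qed.

(** All words starting with [Some false], minus those over two letters. *)
Lemma card_codes (n : nat) : #|codes n| = (3 ^ n - 2 ^ n)%N.
Proof.
pose F (P : pred (option bool)) (v : 'I_n.+1) : pred (option bool) :=
  if v == ord0 then (pred1 (Some false) : pred (option bool)) else P.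
have cardF P : #|family (F P)| = (#|P| ^ n)%N.
  rewrite card_family foldrE big_map big_enum /= big_ord_recl.
  rewrite /F eqxx card1 mul1n.
  by under eq_bigr do rewrite -(inj_eq val_inj) /=; rewrite prod_nat_const card_ord.
have -> : codes n = [set c in family (F predT)] :\:
                    [set c in family (F (predC1 (Some true)))].
  apply/setP => c; rewrite !inE; apply/andP/andP.
    case=> c0 /existsP[t ct]; split; last first.
      by apply/familyP => v; rewrite /F; case: eqVneq => // ->.
    apply/negP => /familyP/(_ t); rewrite /F.
    case: eqVneq => [t0|_]; last by rewrite !inE ct.
    by rewrite -t0 (eqP ct) in c0.
  case=> notf /familyP all; have := all ord0; rewrite /F eqxx inE => c0.
  split=> //; apply: contraR notf; rewrite negb_exists => /forallP no.
  apply/familyP => v; rewrite /F; case: eqVneq => [->//|_].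
  by rewrite !inE no.
rewrite cardsD (finset.setIidPr _).
  rewrite !cardsE !cardF //; congr (_ ^ _ - _ ^ _)%N.
    by rewrite card_option card_bool.
  by have := cardC1 (Some true); rewrite card_option card_bool.
apply/fintype.subsetP => c; rewrite !inE => /familyP all; apply/familyP => v.
by have := all v; rewrite /F; case: ifP.
Qed.

(** * The number of vertices *)

Local Open Scope classical_set_scope.
Local Open Scope card_scope.

Lemma card_eq_finset (T : finType) (A : {set T}) : [set` A] #= `I_#|A|.
Proof.
have -> : [set` A] = [set enum_val i | i in [set: 'I_#|A|]].
  apply/seteqP; split=> [x /= xA|_ [i _ <-]]; last exact: enum_valP.
  by exists (enum_rank_in xA x); rewrite ?enum_rankK_in.
apply: card_eq_trans (inj_card_eq _) _; first by move=> i j _ _; apply: enum_val_inj.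
by rewrite card_eq_sym card_II.
Qed.

Theorem proposition3p14 (R : realType) (n : nat) :
  vertices (CRYD R n) #= `I_(3 ^ n - 2 ^ n)%N.
Proof.
have -> : vertices (CRYD R n) =
    [set fork_flow R (pathA c) (pathB c) | c in [set` codes n]].
  apply/seteqP; split=> [f vf|_ [c /= Cc <-]]; last first.
    exact/fork_vertex/codes_fork.
  have [Cf minf] := (flow_vertexP _ _).1 vf.
  have [A [B [forkAB suppAB]]] := support_fork Cf.
  have [c Cc cE] := fork_code R forkAB.
  exists c => //; rewrite -cE; apply: minf; first exact: fork_in_CRYD.
  by move=> k fk; rewrite -weight_val weight_fork suppAB // weight_val.
apply: card_eq_trans (inj_card_eq _) _.
  by move=> c d; rewrite !inE => Cc Cd; apply: (code_flow_inj Cc Cd).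
by rewrite -card_codes card_eq_finset.
Qed.
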